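(* For every real number $\kappa$ with $0\le\kappa<\frac58$ there exists a positive integer $n_\kappa$ such that for every integer $n\ge n_\kappa$ and every doubly stochastic $n\times n$ matrix $\mathcal M$, there exists a directed $(2n-1)$-regular multigraph $G$ on vertex set $[n]$ whose throughput with respect to $\mathcal M$ is at least $\kappa$ (i.e., $G$ hosts $\kappa\mathcal M$).
   Context: Let $n\ge 1$ and $[n]=\{1,\dots,n\}$. Networks are finite directed multigraphs on vertex set $[n]$; self-loops and parallel arcs are allowed. A directed multigraph is directed $r$-regular if every vertex has exactly $r$ outgoing and exactly $r$ incoming arcs (a self-loop at $v$ counts as one outgoing and one incoming arc of $v$). A path is a non-empty sequence of arcs $((u_1,v_1),\dots,(u_\ell,v_\ell))$ with $v_i=u_{i+1}$ for $i<\ell$; it goes from $u_1$ to $v_\ell$ and has length $\ell\ge 1$ (so demand from a vertex to itself must use at least one arc, e.g. a self-loop). An $n\times n$ matrix is doubly stochastic if all entries are nonnegative and every row and every column sums to $1$. In a directed $(2n-1)$-regular multigraph $G$ on $[n]$ every arc has capacity $\frac{1}{2n-1}$. $G$ hosts a nonnegative $n\times n$ matrix $\mathcal M=(a_{i,j})$ if there is a finite collection $\{(P_k,d_k)\}$, where each $P_k$ is a path in $G$ from some $s_k$ to some $t_k$ and $d_k\ge 0$, such that $\sum_{k:\,s_k=u,\,t_k=v} d_k=a_{u,v}$ for all $u,v\in[n]$, and for every arc $e$ of $G$ (parallel arcs are distinct arcs) $\sum_{k:\,e\in P_k} d_k\le \frac{1}{2n-1}$. The throughput of $G$ with respect to a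 doubly stochastic $\mathcal M$ is the largest $\theta$ such that $G$ hosts $\theta\mathcal M$. *)

(* Defs.v *)
From mathcomp Require Import all_boot all_order all_algebra.
From mathcomp Require Import reals.
Set Implicit Arguments. Unset Strict Implicit. Unset Printing Implicit Defensive.
Import Order.TTheory GRing.Theory Num.Theory.
Local Open Scope ring_scope.

(* A directed multigraph on vertex set 'I_n (= [n], shifted to 0-based):
   a finite list of arcs (u,v); parallel arcs and self-loops allowed;
   arcs are identified by their position in the list, so parallel arcs
   are distinct arcs. *)
Record multigraph (n : nat) := Multigraph { arcs : seq ('I_n * 'I_n) }.

Definition arc_id n (G : multigraph n) := 'I_(size (arcs G)).

Definition arc n (G : multigraph n) (e : arc_id G) : 'I_n * 'I_n :=
  tnth (in_tuple (arcs G)) e.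

Definition outdeg n (G : multigraph n) (v : 'I_n) : nat :=
  count (fun a => a.1 == v) (arcs G).
Definition indeg n (G : multigraph n) (v : 'I_n) : nat :=
  count (fun a => a.2 == v) (arcs G).

Definition regular n (G : multigraph n) (r : nat) : Prop :=
  forall v : 'I_n, outdeg G v = r /\ indeg G v = r.

Definition is_path n (G : multigraph n) (p : seq (arc_id G)) : bool :=
  match p with
  | [::] => false
  | e :: p' => path (fun e f => (arc e).2 == (arc f).1) e p'
  end.

Definition endpoints n (G : multigraph n) (p : seq (arc_id G))
  : option ('I_n * 'I_n) :=
  match p with
  | [::] => None
  | e :: p' => Some ((arc e).1, (arc (last e p')).2)
  end.

Definition hosts_cap (R : realType) n (G : multigraph n) (c : R)
    (M : 'M[R]_n) : Prop :=
  exists fl : seq (seq (arc_id G) * R),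
    [/\ all (fun k => is_path k.1) fl,
        all (fun k => 0 <= k.2) fl,
        (forall u v : 'I_n,
            \sum_(k <- fl | endpoints k.1 == Some (u, v)) k.2 = M u v) &
        (forall e : arc_id G, \sum_(k <- fl | e \in k.1) k.2 <= c)].

(* capacity 1/(2n-1) for (2n-1)-regular multigraphs on [n] *)
Definition hosts (R : realType) n (G : multigraph n) (M : 'M[R]_n) : Prop :=
  hosts_cap G (1 / ((2 * n - 1)%N)%:R) M.

Definition doubly_stochastic (R : realType) n (M : 'M[R]_n) : Prop :=
  [/\ forall i j, 0 <= M i j,
      forall i, \sum_j M i j = 1 &
      forall j, \sum_i M i j = 1].

(* Main.v *)
(* Put N = 2n - 1 and y = kappa N M, whose lines (rows and columns) sum to at
   most about 5n/4, and let f be the fractional part of y.  The Beck-Fiala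
   theorem rounds f to a 0/1 matrix b so that along every line both the sum of b
   and its f-weighted sum are within 4 of those of f.  The arcs counted by
   floor(y) + b carry y directly, except for the shortage (1 - b) f, whose line
   sums are at most those of (1 - f) f plus 4, hence at most n/4 + 4.  About 3n/4
   units of degree are left at each vertex.  They are spent on a circulant
   digraph of degree D, in which any two vertices are joined by at least
   2D - n > n/2 paths of length two; spreading the shortage evenly over these
   paths loads each arc by at most 1. *)
Require Import Defs.
From mathcomp Require Import all_boot all_order all_algebra.
From mathcomp Require Import reals.
From mathcomp Require Import lra zify.
Import Order.TTheory GRing.Theory Num.Theory.
Local Open Scope ring_scope.
Set Implicit Arguments. Unset Strict Implicit. Unset Printing Implicit Defensive.

(** * Routing along paths of at most two arcs *)

Lemma sum_arc (V : nmodType) n (G : multigraph n) (F : 'I_n * 'I_n -> V) :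
  \sum_(e : arc_id G) F (Defs.arc e) = \sum_p F p *+ count_mem p (arcs G).
Proof.
rewrite /Defs.arc /arc_id -(big_tnth _ _ (arcs G) xpredT F).
elim: (arcs G) => [|a s IHs]; first by rewrite big_nil big1.
rewrite big_cons IHs /= (bigD1 a) //= [RHS](bigD1 a) //= eqxx mulrSr addrA.
rewrite [F a + _]addrC; congr (_ + _); apply: eq_bigr => p /negPf.
by rewrite eq_sym => ->.
Qed.

(** In units of [c], [d] is direct traffic and [w i k j] is traffic from [i] to [j] through [k].
    Sharing it equally among parallel arcs reduces the capacity constraint to a comparison of load
    and multiplicity for each ordered pair of vertices. *)
Lemma two_hop_hosts (R : realType) n (G : multigraph n) (c : R) (Y : 'M[R]_n)
    (d : 'I_n -> 'I_n -> R) (w : 'I_n -> 'I_n -> 'I_n -> R) :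
  0 <= c -> (forall i j, 0 <= d i j) -> (forall i k j, 0 <= w i k j) ->
  (forall i j, Y i j = d i j + \sum_k w i k j) ->
  (forall i k, d i k + \sum_j w i k j + \sum_j w j i k
               <= (count_mem (i, k) (arcs G))%:R) ->
  hosts_cap G c (c *: Y).
Proof.
move=> c0 d0 w0 YE load; set m := fun p => (count_mem p (arcs G))%:R : R.
have m0 p : 0 <= m p by exact: ler0n.
have sd0 i k : 0 <= \sum_j w i k j by exact: sumr_ge0.
have sc0 i k : 0 <= \sum_j w j i k by exact: sumr_ge0.
(* Where there is no arc, the load bound forces all traffic to vanish, so the value 0 of a division
   by 0 in [D] and [W] is the right one. *)
have mz i k : m (i, k) = 0 ->
    [/\ d i k = 0, forall j, w i k j = 0 & forall j, w j i k = 0].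
  move=> mik; have := load i k; rewrite -/(m (i, k)) mik => ld.
  have := d0 i k; have := sd0 i k; have := sc0 i k => a1 a2 a3.
  split; first by lra.
    move=> j; have /eqP : \sum_j w i k j = 0 by lra.
    by rewrite psumr_eq0 // => /allP/(_ j (mem_index_enum _))/eqP.
  move=> j; have /eqP : \sum_j w j i k = 0 by lra.
  by rewrite psumr_eq0 // => /allP/(_ j (mem_index_enum _))/eqP.
pose D p := c * d p.1 p.2 / m p.
pose W p q : R := if p.2 == q.1 then c * w p.1 p.2 q.2 / (m p * m q) else 0.
have W0 p q : 0 <= W p q by rewrite /W; case: ifP => // _; rewrite divr_ge0 ?mulr_ge0.
have D0 p : 0 <= D p by rewrite /D divr_ge0 ?mulr_ge0.
(* [Wr] and [Wl] are [W] summed over the parallel copies of the second and of the first arc. *)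
pose Wr p q : R := if p.2 == q.1 then c * w p.1 p.2 q.2 / m p else 0.
pose Wl p q : R := if p.2 == q.1 then c * w p.1 p.2 q.2 / m q else 0.
have WrE p q : W p q * m q = Wr p q.
  rewrite /W /Wr; case: eqP => [E|_]; last by rewrite mul0r.
  case: (eqVneq (m q) 0) => [z|nz].
    move: z; case: p q E => [i k] [k' j] /= <- /[dup] z /mz [_ _ ->].
    by rewrite z !(mulr0, mul0r).
  by rewrite invfM -!mulrA mulVf ?mulr1.
have WlE p q : W p q * m p = Wl p q.
  rewrite /W /Wl; case: eqP => [E|_]; last by rewrite mul0r.
  case: (eqVneq (m p) 0) => [z|nz].
    move: z; case: p q E => [i k] [k' j] /= <- /[dup] z /mz [_ -> _].
    by rewrite z !(mulr0, mul0r).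
  by rewrite [m p * _]mulrC invfM -!mulrA mulVf ?mulr1.
have WrmE p q : Wr p q * m p = if p.2 == q.1 then c * w p.1 p.2 q.2 else 0.
  rewrite /Wr; case: eqP => [E|_]; last by rewrite mul0r.
  case: (eqVneq (m p) 0) => [z|nz]; last by rewrite divfK.
  by move: z; case: p {E} => [i k] /= /[dup] z /mz [_ -> _]; rewrite z !(mulr0, mul0r).
have sumE F : \sum_(e : arc_id G) F (Defs.arc e) = \sum_p F p * m p.
  by rewrite sum_arc; apply: eq_bigr => p _; rewrite mulr_natr.
pose P2 := [seq ef : arc_id G * arc_id G <- index_enum _ |
            (Defs.arc ef.1).2 == (Defs.arc ef.2).1].
exists ([seq ([:: e], D (Defs.arc e)) | e <- index_enum (arc_id G)] ++
   [seq ([:: ef.1; ef.2], W (Defs.arc ef.1) (Defs.arc ef.2)) | ef <- P2]); split.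
- rewrite all_cat !all_map; apply/andP; split; first exact/allP.
  apply/allP => -[e f]; rewrite mem_filter /= => /andP[-> _] //.
- rewrite all_cat !all_map; apply/andP; split; apply/allP => x _ /=; by [apply: D0 | apply: W0].
- move=> u v; rewrite big_cat !big_map big_filter_cond /= mxE YE mulrDr mulr_sumr.
  congr (_ + _).
    rewrite big_mkcond /= (sumE (fun p => if Some (p.1, p.2) == Some (u, v) then D p else 0)).
    rewrite (bigD1 (u, v)) //= eqxx big1 ?addr0.
      rewrite /D /=; case: (eqVneq (m (u, v)) 0) => [z|nz]; last by rewrite divfK.
      by have [-> _ _] := mz _ _ z; rewrite !(mulr0, mul0r).
    move=> -[i j] ne; rewrite (_ : (_ == _) = false) ?mul0r //=.
    by apply: contraNF ne => /eqP[-> ->].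
  rewrite big_mkcond -(pair_bigA _ (fun e f => if ((Defs.arc e).2 == (Defs.arc f).1) &&
     (Some ((Defs.arc e).1, (Defs.arc f).2) == Some (u, v))
     then W (Defs.arc e) (Defs.arc f) else 0)) /=.
  transitivity (\sum_p \sum_q if (p.2 == q.1) && (Some (p.1, q.2) == Some (u, v))
        then c * w p.1 p.2 q.2 else 0).
    rewrite (sumE (fun p => \sum_f if (p.2 == (Defs.arc f).1) &&
        (Some (p.1, (Defs.arc f).2) == Some (u, v)) then W p (Defs.arc f) else 0)).
    apply: eq_bigr => p _.
    rewrite (sumE (fun q => if (p.2 == q.1) && (Some (p.1, q.2) == Some (u, v))
        then W p q else 0)) mulr_suml; apply: eq_bigr => q _.
    case: ifP => [/andP[E _]|_]; last by rewrite !mul0r.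
    by rewrite WrE WrmE E.
  rewrite -(pair_bigA _ (fun i k => \sum_q if (k == q.1) && (Some (i, q.2) == Some (u, v))
        then c * w i k q.2 else 0)) /= (bigD1 u) //= [X in _ + X]big1 ?addr0.
    apply: eq_bigr => k _; rewrite (bigD1 (k, v)) //= !eqxx /= big1 ?addr0 //.
    move=> -[k' j] /= ne; case: ifP => // /andP[/eqP E /eqP[E']].
    by rewrite E E' eqxx in ne.
  move=> i ne; rewrite big1 // => k _; rewrite big1 // => q _.
  by case: ifP => // /andP[_ /eqP[E _]]; rewrite E eqxx in ne.
move=> e; rewrite big_cat !big_map big_filter_cond /=.
have -> : \sum_(e' | e \in [:: e']) D (Defs.arc e') = D (Defs.arc e).
  by apply: big_pred1 => e'; rewrite inE eq_sym.
apply: (@le_trans _ _ (D (Defs.arc e) +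
    (\sum_f W (Defs.arc e) (Defs.arc f) + \sum_f W (Defs.arc f) (Defs.arc e)))).
  rewrite lerD2l.
  rewrite big_mkcond -(pair_bigA _ (fun e' f => if ((Defs.arc e').2 == (Defs.arc f).1) &&
     (e \in [:: e'; f]) then W (Defs.arc e') (Defs.arc f) else 0)) /=.
  (* A loop used twice by a path loads itself once; counting both positions gives an upper bound. *)
  apply: (@le_trans _ _ (\sum_e' \sum_f (
      (if e' == e then W (Defs.arc e') (Defs.arc f) else 0) +
      (if f == e then W (Defs.arc e') (Defs.arc f) else 0)))).
    apply: ler_sum => e' _; apply: ler_sum => f _.
    have := W0 (Defs.arc e') (Defs.arc f); rewrite !inE ![_ == e]eq_sym.
    by case: (_ == _); case: (e == e'); case: (e == f) => /=; lra.
  under [leLHS]eq_bigr do rewrite big_split /=.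
  rewrite big_split /= [X in _ + X]exchange_big /= lerD //.
    rewrite (bigD1 e) //= eqxx [X in _ + X]big1 ?addr0 // => e' /negPf ->.
    by rewrite big1.
  rewrite (bigD1 e) //= eqxx [X in _ + X]big1 ?addr0 // => e' /negPf ->.
  by rewrite big1.
rewrite (sumE (W (Defs.arc e))) (sumE (fun p => W p (Defs.arc e))).
under eq_bigr do rewrite WrE.
under [X in _ + (_ + X)]eq_bigr do rewrite WlE.
case: (Defs.arc e) => i k; rewrite /D /Wr /Wl /=.
have -> : \sum_q (if k == q.1 then c * w i k q.2 / m (i, k) else 0) =
    c * (\sum_j w i k j) / m (i, k).
  rewrite -(pair_bigA _ (fun k' j => if k == k' then c * w i k j / m (i, k) else 0)) /=.
  rewrite (bigD1 k) //= eqxx [X in _ + X]big1 ?addr0 -?mulr_suml -?mulr_sumr // => k'.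
  by rewrite eq_sym => /negPf ->; rewrite big1.
have -> : \sum_p (if p.2 == i then c * w p.1 p.2 k / m (i, k) else 0) =
    c * (\sum_j w j i k) / m (i, k).
  rewrite -(pair_bigA _ (fun j i' => if i' == i then c * w j i' k / m (i, k) else 0)) /=.
  rewrite mulr_sumr mulr_suml; apply: eq_bigr => j _.
  by rewrite (bigD1 i) //= eqxx big1 ?addr0 // => i' /negPf ->.
rewrite addrA -!mulrDl -!mulrDr.
have [->|nz] := eqVneq (m (i, k)) 0; first by rewrite invr0 mulr0.
by rewrite ler_pdivrMr ?lt0r ?nz ?m0 // ler_wpM2l // load.
Qed.

(** * Completion to a regular multigraph *)

(** Out-degrees and in-degrees both sum to the number of arcs. While this is below [n * r], some
    vertex lacks an outgoing arc and some vertex an incoming one; the arc joining them can be added,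
    as loops and parallel arcs are allowed. *)
Lemma regular_completion n r (s : seq ('I_n * 'I_n)) :
  (forall v, count (fun a => a.1 == v) s <= r)%N ->
  (forall v, count (fun a => a.2 == v) s <= r)%N ->
  exists s', regular (Multigraph (s' ++ s)) r.
Proof.
have sz (h : 'I_n * 'I_n -> 'I_n) t : (\sum_v count (fun a => h a == v) t = size t)%N.
  elim: t => [|a t IHt]; first by rewrite big1.
  rewrite /= big_split /= IHt (bigD1 (h a)) //= eqxx big1 // => v.
  by rewrite eq_sym => /negPf ->.
have deficit (h : 'I_n * 'I_n -> 'I_n) t : (size t < n * r)%N ->
    exists v, (count (fun a => h a == v) t < r)%N.
  move=> lt_t; apply/existsP; apply: contraTT lt_t.
  rewrite negb_exists -leqNgt -(sz h t) => /forallP ge_r.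
  rewrite -[n in (n * r)%N](card_ord n) -sum_nat_const leq_sum // => v _.
  by rewrite leqNgt.
have [k] := ubnP (n * r - size s)%N; elim: k s => // k IHk s lt_k le1 le2.
have [full|lt_s] := leqP (n * r) (size s).
  exists [::] => v /=; rewrite /outdeg /indeg /=.
  have tight (h : 'I_n * 'I_n -> 'I_n) :
      (forall u, count (fun a => h a == u) s <= r)%N -> count (fun a => h a == v) s = r.
    move=> le; apply/eqP; rewrite eqn_leq le /=; move: full.
    have -> : (n * r = \sum_(u < n) r)%N by rewrite sum_nat_const card_ord.
    rewrite -(sz h s) (bigD1 v) //= [X in (_ <= X)%N](bigD1 v) //= => full.
    rewrite -(leq_add2r (\sum_(u < n | u != v) r)); apply: leq_trans full _.
    by rewrite leq_add2l leq_sum.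
  by split; apply: (tight (fun a => _)).
have [i lt_i] := deficit fst s lt_s; have [j lt_j] := deficit snd s lt_s.
have [||| s' reg] := IHk ((i, j) :: s).
- by rewrite /=; lia.
- by move=> v /=; have [<-|_] := eqVneq i v; rewrite ?add0n // add1n.
- by move=> v /=; have [<-|_] := eqVneq j v; rewrite ?add0n // add1n.
by exists (rcons s' (i, j)); rewrite cat_rcons.
Qed.

(** * Circulant digraphs and their two-arc paths *)

Lemma card_ord_lt n D : (D <= n)%N -> #|[set i : 'I_n | (i < D)%N]| = D.
Proof.
move=> le_Dn; rewrite cardsE -sum1_card -[RHS](card_ord D) -[RHS]sum1_card.
by rewrite [RHS](big_ord_widen n (fun=> 1%N)).
Qed.

(* Any other D-regular digraph without parallel arcs would do as well. *)
Definition circulant n D (i j : 'I_n.+1) := (((j - i)%R : 'I_n.+1) < D)%N.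

Lemma card_circulant_out n D (i : 'I_n.+1) :
  (D <= n.+1)%N -> #|[set j | circulant D i j]| = D.
Proof.
move=> le_Dn; rewrite -[RHS](card_ord_lt le_Dn).
rewrite -[RHS](card_imset _ (addIr i)); apply: eq_card => j.
rewrite inE; apply/idP/imsetP => [lt|[k + ->]]; last by rewrite inE /circulant addrK.
by exists (j - i); rewrite ?subrK // inE.
Qed.

Lemma card_circulant_in n D (j : 'I_n.+1) :
  (D <= n.+1)%N -> #|[set i | circulant D i j]| = D.
Proof.
move=> le_Dn; rewrite -[RHS](card_ord_lt le_Dn).
have inj : injective (fun k => j - k) by move=> k l /addrI /oppr_inj.
rewrite -[RHS](card_imset _ inj); apply: eq_card => i.
rewrite inE; apply/idP/imsetP => [lt|[k + ->]]; last by rewrite inE /circulant subKr.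
by exists (j - i); rewrite ?subKr // inE.
Qed.

(** Inclusion-exclusion for the [D] out-neighbours of [i] and the [D] in-neighbours of [j] among
    [n.+1] vertices. *)
Lemma card_circulant_between n D (i j : 'I_n.+1) : (D <= n.+1)%N ->
  (D.*2 <= #|[set k | circulant D i k && circulant D k j]| + n.+1)%N.
Proof.
move=> le_Dn; have := cardsUI [set k | circulant D i k] [set k | circulant D k j].
rewrite card_circulant_out // card_circulant_in // -addnn => <-.
rewrite addnC leq_add //; last by rewrite -[X in (_ <= X)%N]card_ord max_card.
by apply: subset_leq_card; apply/subsetP => k; rewrite !inE.
Qed.

(** * Beck-Fiala rounding *)

(** With more unknowns than equations, the coefficient matrix indexed by [S] and [A] has a nonzero
    left kernel vector, which is extended by 0 outside [S]. *)
Lemma underdetermined_solution (K : fieldType) (E C : finType) (S : {set E})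
    (A : {set C}) (a : C -> E -> K) : (#|A| < #|S|)%N ->
  exists y : E -> K, [/\ exists e, y e != 0, forall e, e \notin S -> y e = 0 &
    forall c, c \in A -> \sum_e a c e * y e = 0].
Proof.
move=> lt_AS; have [e0 e0S] : exists e0, e0 \in S by apply/card_gt0P; lia.
pose B : 'M[K]_(#|S|, #|A|) := \matrix_(i, j) a (enum_val j) (enum_val i).
have : kermx B != 0.
  rewrite -mxrank_eq0 mxrank_ker subn_eq0 -ltnNge.
  exact: leq_ltn_trans (rank_leq_col B) lt_AS.
rewrite -nz_row_eq0 => nz; set v := nz_row _ in nz.
have vB : v *m B = 0 by apply/sub_kermxP; exact: nz_row_sub.
exists (fun e => if e \in S then v 0 (enum_rank_in e0S e) else 0); split.
- have /rV0Pn [i vi] := nz; exists (enum_val i).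
  by rewrite enum_valP enum_valK_in.
- by move=> e /negPf ->.
move=> c cA; have := congr1 (fun M : 'rV_ _ => M 0 (enum_rank_in cA c)) vB.
rewrite !mxE; apply: etrans; rewrite (bigID (mem S)) /= [X in _ + X]big1 ?addr0.
  rewrite big_enum_val /=; apply: eq_bigr => i _.
  by rewrite mxE enum_valP enum_valK_in enum_rankK_in // mulrC.
by move=> e /negPf ->; rewrite mulr0.
Qed.

Lemma move_to_boundary (R : realFieldType) (E : finType) (x y : E -> R) :
  (forall e, 0 <= x e <= 1) -> (forall e, y e != 0 -> 0 < x e < 1) ->
  (exists e, y e != 0) ->
  exists l : R, (forall e, 0 <= x e + l * y e <= 1) /\
    exists2 e, y e != 0 & x e + l * y e = 0 \/ x e + l * y e = 1.
Proof.
move=> x01 yS [e1 ye1].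
(* The time at which coordinate [e] reaches 1 or 0 along [y]; the least one is the first exit from
   the cube. *)
pose tau e := if 0 < y e then (1 - x e) / y e else - x e / y e.
have [e0 ye0 tmin] := arg_minP tau (P := fun e => y e != 0) ye1.
have tau0 e : y e != 0 -> 0 < tau e.
  move=> ye; have /andP[xe0 xe1] := yS e ye; rewrite /tau; case: (ltrP 0 (y _)) => ye'.
    by rewrite divr_gt0 ?subr_gt0.
  by rewrite mulNr -mulrN -invrN divr_gt0 // oppr_gt0 lt_neqAle ye.
exists (tau e0); split.
  move=> e; have [->|ye] := eqVneq (y e) 0; first by rewrite mulr0 addr0.
  have := tmin e ye; have := tau0 e0 ye0; have /andP[xe0 xe1] := yS e ye.
  rewrite {3}/tau; case: (ltrP 0 (y _)) => ye' l0.
    by rewrite ler_pdivlMr // => le; have := mulr_ge0 (ltW l0) (ltW ye'); lra.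
  have ye2 : y e < 0 by rewrite lt_neqAle ye.
  rewrite ler_ndivlMr // => le.
  have := mulr_ge0_le0 (ltW l0) ye'; lra.
exists e0 => //; rewrite /tau; case: (ltrP 0 (y _)) => _; rewrite divfK //.
  by right; lra.
by left; lra.
Qed.

(* The Beck-Fiala argument: as long as some coordinate is fractional, fewer
   constraints involve more than t fractional coordinates than there are
   fractional coordinates, so x can be moved without changing the value of any
   of these constraints.  Once a constraint involves at most t fractional
   coordinates, it can change by at most t. *)
Lemma beck_fiala (R : realFieldType) (E C : finType) (a : C -> E -> R) t
    (x : E -> R) :
  (forall c e, `|a c e| <= 1) ->
  (forall e, (#|[set c | (a c e != 0)%R]| <= t)%N) ->
  (forall e, 0 <= x e <= 1) ->
  exists b : E -> bool, forall c, `|\sum_e a c e * ((b e)%:R - x e)| <= t%:R.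
Proof.
(* The induction also has to keep the coordinates that are already 0 or 1. *)
move=> a1 at_ x01; suff [b [_ ?]] : exists b : E -> bool,
    (forall e, ~~ (0 < x e < 1) -> (b e)%:R = x e) /\
    forall c, `|\sum_e a c e * ((b e)%:R - x e)| <= t%:R by exists b.
pose S (x : E -> R) := [set e | 0 < x e < 1].
have [k] := ubnP #|S x|; elim: k x x01 => // k IHk x x01 ltk.
have [S0|Sn0] := posnP #|S x|.
  exists (fun e => x e == 1); have bE e : (x e == 1)%:R = x e.
    move/eqP: S0; rewrite cards_eq0 => /eqP/setP/(_ e); rewrite !inE.
    have := x01 e; have [->//|ne] := eqVneq (x e) 1; rewrite mulr0n.
    rewrite le_eqVlt => /andP[/orP[/eqP//|->]].
    by rewrite le_eqVlt (negPf ne) /= => ->.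
  split=> // c; rewrite big1 ?normr0 // => e _.
  by rewrite bE subrr mulr0.
pose A := [set c | (t < #|[set e in S x | (a c e != 0)%R]|)%N].
have ltA : (#|A| < #|S x|)%N.
  (* Double counting of nonzero coefficients: more than [t] for each constraint in [A], at most [t]
     for each coordinate in [S x]. *)
  have : (#|A| * t.+1 <= #|S x| * t)%N; last by nia.
  rewrite -!sum_nat_const.
  apply: (@leq_trans (\sum_(c in A) \sum_(e in S x) (a c e != 0)%R)%N).
    apply: leq_sum => c; rewrite inE => /leq_trans; apply.
    rewrite -sum1_card -big_mkcondr /= leq_eqVlt; apply/orP; left; apply/eqP.
    by apply: eq_bigl => e; rewrite !inE.
  rewrite exchange_big leq_sum // => e _; apply: leq_trans (at_ e).
  rewrite -sum1_card (big_mkcond (fun i => i \in A)) [X in (_ <= X)%N]big_mkcond.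
  by apply: leq_sum => c _; rewrite inE; case: ifP => //; case: (_ != _).
have [y [yn0 yS yA]] := underdetermined_solution a ltA.
have yS' e : y e != 0 -> 0 < x e < 1.
  by apply: contraR => ne; rewrite yS // inE.
have [l [x'01 [e0 ye0 hit]]] := move_to_boundary x01 yS' yn0.
set x' := (fun e => x e + l * y e).
have x'E e : e \notin S x -> x' e = x e by move=> /yS; rewrite /x' => ->; rewrite mulr0 addr0.
have [] := IHk x' x'01.
  (* Integral coordinates do not move and [e0] becomes integral, so the fractional set shrinks
     strictly. *)
  rewrite -ltnS; apply: leq_trans ltk; rewrite ltnS; apply: proper_card.
  apply/properP; split.
    by apply/subsetP => e; apply: contraTT => ne; rewrite inE x'E //; rewrite inE in ne.
  exists e0; rewrite inE ?yS' //.
  by rewrite /x'; case: hit => ->; rewrite ltxx ?andbF.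
move=> b [bE bC]; have bE' e : e \notin S x -> (b e)%:R = x e.
  move=> ne; rewrite bE x'E //; by rewrite inE in ne.
exists b; split=> [e ne|c]; first by rewrite bE' // inE.
have [cA|] := boolP (c \in A).
  suff -> : \sum_e a c e * ((b e)%:R - x e) = \sum_e a c e * ((b e)%:R - x' e) by [].
  rewrite -[RHS]addr0 -[X in _ + X](mulr0 l) -[X in l * X](yA c cA).
  rewrite [X in _ + X]mulr_sumr -big_split.
  by apply: eq_bigr => e _; rewrite /x' /=; lra.
rewrite inE -leqNgt => cnt; apply: le_trans (ler_norm_sum _ _ _) _.
apply: (@le_trans _ _ (\sum_(e in [set e in S x | a c e != 0]) 1)); last first.
  by rewrite sumr_const ler_nat.
rewrite [leRHS]big_mkcond; apply: ler_sum => e _; rewrite inE.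
case: ifP => [_|/negbT].
  rewrite normrM mulr_ile1 // ler_norml.
  by have := x01 e; case: (b e) => /=; lra.
rewrite negb_and negbK => /orP[/bE' ->|/eqP ->].
  by rewrite subrr mulr0 normr0.
by rewrite mul0r normr0.
Qed.


(** Beck-Fiala with [t] equal to 4: an entry lies in one row and one column, and each line carries
    two constraints, with weights 1 and [f]. *)
Lemma matrix_rounding (R : realFieldType) n (f : 'I_n -> 'I_n -> R) :
  (forall i j, 0 <= f i j <= 1) ->
  exists b : 'I_n -> 'I_n -> bool,
    (forall i, `|\sum_j ((b i j)%:R - f i j)| <= 4 /\
               `|\sum_j f i j * ((b i j)%:R - f i j)| <= 4) /\
    (forall j, `|\sum_i ((b i j)%:R - f i j)| <= 4 /\
               `|\sum_i f i j * ((b i j)%:R - f i j)| <= 4).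
Proof.
move=> f01.
pose line (rc : bool) (e : 'I_n * 'I_n) := if rc then e.1 else e.2.
(* In a constraint [c], the first boolean chooses row or column and the second the weight. *)
pose a (c : bool * bool * 'I_n) (e : 'I_n * 'I_n) : R :=
  if line c.1.1 e == c.2 then (if c.1.2 then f e.1 e.2 else 1) else 0.
have [||| b bE] := @beck_fiala R _ _ a 4 (fun e => f e.1 e.2).
- move=> [[rc w] v] [i j]; rewrite /a /=; have := f01 i j.
  by rewrite ler_norml; case: ifP => _; [case: w|] => ?; lra.
- move=> e; apply: (@leq_trans #|[set (rw, line rw.1 e) | rw in [set: bool * bool]]|).
    apply: subset_leq_card; apply/subsetP => -[[rc w] v]; rewrite inE /a /=.
    case: ifP => [/eqP <- _|_]; last by rewrite eqxx.
    by apply/imsetP; exists (rc, w); rewrite ?inE.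
  by apply: leq_trans (leq_imset_card _ _) _; rewrite cardsT card_prod card_bool.
- by move=> e; apply: f01.
have rowE (F : 'I_n -> 'I_n -> R) v :
    \sum_e (if e.1 == v then F e.1 e.2 else 0) = \sum_j F v j.
  rewrite -(pair_bigA _ (fun i j => if i == v then F i j else 0)) /=.
  by rewrite (bigD1 v) //= eqxx [X in _ + X]big1 ?addr0 // => i /negPf ->; rewrite big1.
have colE (F : 'I_n -> 'I_n -> R) v :
    \sum_e (if e.2 == v then F e.1 e.2 else 0) = \sum_i F i v.
  rewrite -(pair_bigA _ (fun i j => if j == v then F i j else 0)) /=.
  apply: eq_bigr => i _.
  by rewrite (bigD1 v) //= eqxx [X in _ + X]big1 ?addr0 // => j /negPf ->.
pose F w i j := (if w then f i j else 1) * ((b (i, j))%:R - f i j).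
have aE rc w v : \sum_e a (rc, w, v) e * ((b e)%:R - f e.1 e.2) =
    \sum_e if line rc e == v then F w e.1 e.2 else 0.
  by apply: eq_bigr => -[i j] _; rewrite /a /=; case: ifP => _; rewrite ?mul0r.
have rowF w v : `|\sum_j F w v j| <= 4 
  by rewrite -(rowE (F w)); have := bE (true, w, v); rewrite aE.
have colF w v : `|\sum_i F w i v| <= 4.
  by rewrite -(colE (F w)); have := bE (false, w, v); rewrite aE.
exists (fun i j => b (i, j)); split=> v; split.
- by have := rowF false v; rewrite /F; under eq_bigr do rewrite mul1r.
- exact: rowF true v.
- by have := colF false v; rewrite /F; under eq_bigr do rewrite mul1r.
exact: colF true v.
Qed.

(** * Assembling the network from the rounded demand *)

Lemma seq_of_multiplicities (T : finType) (g : T -> nat) :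
  exists s : seq T, forall P : pred T, count P s = (\sum_(p | P p) g p)%N.
Proof.
exists (flatten [seq nseq (g p) p | p <- index_enum T]) => P.
rewrite count_flatten -map_comp sumnE big_map [RHS]big_mkcond.
by apply: eq_bigr => p _; rewrite /= count_nseq; case: (P p); rewrite ?mul1n.
Qed.

(** The degree [N] pays for the rounded demand, at most [K + 4] per line, and for a circulant of
    degree [D]. The last inequality provides at least [m.+1 / 2 + 8] two-arc paths between any two
    vertices, twice the bound on the line sums of the shortage. *)
Lemma hosts_rounded_demand (R : realType) m N D (Y : 'M[R]_m.+1) (K c : R) :
  0 <= c -> (forall i j, 0 <= Y i j) ->
  (forall i, \sum_j Y i j <= K) -> (forall j, \sum_i Y i j <= K) ->
  K + 4 + D%:R <= N%:R -> (D <= m.+1)%N ->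
  m.+1%:R / 2 + 8 <= D%:R * 2 - m.+1%:R :> R ->
  exists G : multigraph m.+1, regular G N /\ hosts_cap G c (c *: Y).
Proof.
move=> c0 Y0 rowK colK KDN leD geD.
pose y i j := Num.truncn (Y i j); pose f i j := Y i j - (y i j)%:R.
have f01 i j : 0 <= f i j <= 1.
  have := truncn_itv (Y0 i j); rewrite /f /y -natr1; lra.
have [b [rowb colb]] := matrix_rounding f01.
pose H := @circulant m D.
pose g i j := (y i j + b i j + H i j)%N.
have sumH (h : 'I_m.+1 -> bool) : (\sum_j (h j : nat) = #|[set j | h j]|)%N.
  rewrite -sum1_card big_mkcond [RHS]big_mkcond; apply: eq_bigr => j _.
  by rewrite inE; case: (h j).
have line (x : 'I_m.+1 -> R) (t : 'I_m.+1 -> nat) (e h : 'I_m.+1 -> bool) :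
    \sum_j x j <= K -> `|\sum_j ((e j)%:R - (x j - (t j)%:R))| <= 4 ->
    #|[set j | h j]| = D -> (\sum_j (t j + e j + h j) <= N)%N.
  move=> leK; rewrite ler_norml !sumrB => /andP[_ le4] cardh.
  rewrite -(ler_nat R) !big_split /= (sumH h) cardh !natrD !natr_sum.
  by lra.
have [s sE] := seq_of_multiplicities (fun p : 'I_m.+1 * 'I_m.+1 => g p.1 p.2).
have [v|v|s' reg] := @regular_completion m.+1 N s.
- rewrite sE (reindex_onto (fun j => (v, j)) snd) /=; last first.
    by move=> [i j] /= /eqP ->.
  rewrite (eq_bigl xpredT) => [|j]; last by rewrite !eqxx.
  apply: line (rowK v) _ _; first by have [] := rowb v.
  exact: card_circulant_out.
- rewrite sE (reindex_onto (fun i => (i, v)) fst) /=; last first.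
    by move=> [i j] /= /eqP ->.
  rewrite (eq_bigl xpredT) => [|j]; last by rewrite !eqxx.
  apply: line (colK v) _ _; first by have [] := colb v.
  exact: card_circulant_in.
exists (Multigraph (s' ++ s)); split=> //.
pose q i j : R := #|[set k | H i k && H k j]|%:R.
pose Q : R := m.+1%:R / 2 + 8.
have Q0 : 0 < Q by rewrite /Q; have := ler0n R m.+1; lra.
have leQq i j : Q <= q i j.
  apply: le_trans geD _; rewrite lerBlDr.
  by have := card_circulant_between i j leD; rewrite -(ler_nat R) natrD -muln2 natrM.
(* The shortage: all of [f] where [b] rounds down, nothing where it rounds up. *)
pose z i j := (1 - (b i j)%:R) * f i j.
have z0 i j : 0 <= z i j.
  by rewrite mulr_ge0 //; [case: (b i j) => /=; lra | case/andP: (f01 i j)].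
have zsum (x : 'I_m.+1 -> R) (e : 'I_m.+1 -> bool) :
    `|\sum_j x j * ((e j)%:R - x j)| <= 4 -> \sum_j (1 - (e j)%:R) * x j <= Q / 2.
  (* Replacing [e] by [x] costs at most 4 by the weighted constraint, and [(1 - x) * x <= 1 / 4]; in
     total this is [m.+1 / 4 + 4], which is [Q / 2]. *)
  move=> le4; rewrite (eq_bigr (fun j => (1 - x j) * x j - x j * ((e j)%:R - x j))); last first.
    by move=> j _; lra.
  rewrite sumrB; have : \sum_j (1 - x j) * x j <= \sum_(j < m.+1) 1 / 4.
    by apply: ler_sum => j _; have := sqr_ge0 (x j - 1 / 2); rewrite expr2; lra.
  rewrite sumr_const card_ord -mulr_natr => le; move: le4; rewrite ler_norml /Q.
  lra.
pose w i k j := if H i k && H k j then z i j / q i j else 0.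
have w0 i k j : 0 <= w i k j.
  by rewrite /w; case: ifP => // _; rewrite divr_ge0 // ler0n.
have wle i k j : w i k j <= z i j / Q.
  have lez : z i j / q i j <= z i j / Q.
    by rewrite ler_wpM2l // lef_pV2 ?posrE // (lt_le_trans Q0).
  by rewrite /w; case: ifP => // _; rewrite divr_ge0 // ltW.
apply: (two_hop_hosts (d := fun i j => (y i j)%:R + (b i j)%:R * f i j) (w := w)) => //.
- move=> i j; rewrite addr_ge0 ?mulr_ge0 ?ler0n //; by case/andP: (f01 i j).
- move=> i j; rewrite -big_mkcond /= sumr_const.
  have -> : #|(fun k => H i k && H k j)| = #|[set k | H i k && H k j]| by rewrite cardsE.
  rewrite -[z i j / q i j *+ _]mulr_natr divfK; first by rewrite /z /f; lra.
  by rewrite gt_eqF // (lt_le_trans Q0).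
move=> i k; rewrite /= count_cat natrD.
have -> : count_mem (i, k) s = g i k by rewrite sE (big_pred1 (i, k)).
have half : Q / 2 / Q = 1 / 2 :> R by rewrite mulrAC divff ?gt_eqF.
(* An arc of [H] serves as first hop and as second hop; each role loads it by at most 1/2, so its
   total load fits into one arc. *)
have rowW : \sum_j w i k j <= (H i k)%:R / 2.
  have [Hik|/negbTE Hik] := boolP (H i k); last first.
    by rewrite big1 ?mul0r // => j _; rewrite /w Hik.
  rewrite -half; apply: le_trans (ler_sum _ (fun j _ => wle i k j)) _.
  rewrite -mulr_suml ler_wpM2r ?invr_ge0 ?(ltW Q0) //.
  by apply: (zsum (f i) (b i)); have [] := rowb i.
have colW : \sum_j w j i k <= (H i k)%:R / 2.
  have [Hik|/negbTE Hik] := boolP (H i k); last first.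
    by rewrite big1 ?mul0r // => j _; rewrite /w Hik andbF.
  rewrite -half; apply: le_trans (ler_sum _ (fun j _ => wle j i k)) _.
  rewrite -mulr_suml ler_wpM2r ?invr_ge0 ?(ltW Q0) //.
  by apply: (zsum (f^~ k) (b^~ k)); have [] := colb k.
have bf : (b i k)%:R * f i k <= (b i k)%:R :> R.
  by rewrite ler_piMr ?ler0n //; case/andP: (f01 i k).
have := ler0n R (count_mem (i, k) s'); rewrite /g !natrD; lra.
Qed.

(** * Choice of the parameters *)

Theorem theorem3p3 (R : realType) (kappa : R) :
  0 <= kappa -> kappa < 5 / 8 ->
  exists nk : nat, (0 < nk)%N /\
    forall n : nat, (nk <= n)%N ->
    forall M : 'M[R]_n, doubly_stochastic M ->
    exists G : multigraph n,
      regular G (2 * n - 1) /\ hosts G (kappa *: M).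
Proof.
move=> k0 k58; have e0 : 0 < 5 / 8 - kappa by lra.
(* The first term leaves room for the additive constants in the degree budget; the 20 ensures
   [D <= m.+1]. *)
exists (Num.truncn (10 / (5 / 8 - kappa)) + 20)%N; split; first by rewrite addnS.
case=> [|m]; first by rewrite addnS.
move=> le_n M [M0 rowM colM].
(* The path count needs [D] to be at least [3 * m.+1 / 4 + 4]; adding 5 also covers the rounding
   down. *)
pose N := (2 * m.+1 - 1)%N; pose D := ((3 * m.+1) %/ 4 + 5)%N.
have NE : N%:R = 2 * m.+1%:R - 1 :> R by rewrite /N natrB ?muln_gt0 // natrM.
have N0 : 0 < N%:R :> R by rewrite ltr0n /N; lia.
have leD : (D <= m.+1)%N by rewrite /D; lia.
have D1 : D%:R * 4 <= m.+1%:R * 3 + 20 :> R.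
  by rewrite -!natrM -natrD ler_nat /D; lia.
have D2 : m.+1%:R * 3 + 16 <= D%:R * 4 :> R.
  by rewrite -!natrM -natrD ler_nat /D; lia.
have en : 10 <= m.+1%:R * (5 / 8 - kappa).
  rewrite -ler_pdivrMr //; apply/ltW/(lt_le_trans (truncnS_gt _)).
  by rewrite ler_nat; apply: leq_trans le_n; rewrite -addn1 leq_add2l.
(* The factor [N] in the demand cancels the capacity [1 / N], which leaves [kappa *: M]. *)
have [|i j|i|j||||G [reg host]] := @hosts_rounded_demand R m N D
    ((kappa * N%:R) *: M) (kappa * N%:R) (1 / N%:R).
- by rewrite divr_ge0 // ltW.
- by rewrite mxE !mulr_ge0 // ltW.
- by under eq_bigr do rewrite mxE; rewrite -mulr_sumr rowM mulr1.
- by under eq_bigr do rewrite mxE; rewrite -mulr_sumr colM mulr1.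
- by rewrite NE; lra.
- by [].
- by lra.
exists G; split=> //; move: host; rewrite scalerA mulrCA divfK ?mulr1 //.
by rewrite gt_eqF.
Qed.
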